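(* Consider a two-port port-Hamiltonian system $$\begin{aligned} \dot{x}_1 &= J_1(x_1,x_2)e_1 - R_1(x_1,x_2)e_1 + G_1u_1,\\ \dot{x}_2 &= J_2(x_1,x_2)e_2 - R_2(x_1,x_2)e_2 + G_2(x_1,x_2)u_2,\\ y_1 &= G_1^\top e_1, \qquad e_1=\frac{\partial H}{\partial x_1}(x_1,x_2),\\ y_2 &= G_2^\top(x_1,x_2)e_2, \qquad e_2=\frac{\partial H}{\partial x_2}(x_1,x_2), \end{aligned}$$ where, for $i=1,2$, $J_i(x_1,x_2)=-J_i(x_1,x_2)^\top$ and $e_i^\top R_i(x_1,x_2)e_i\ge 0$ for all $(x_1,x_2)$ and all $e_i$, $G_1$ is an invertible constant matrix, and the partial Hessian $\frac{\partial^2 H}{\partial x_1^2}(x_1,x_2)$ has full rank everywhere. Then for every $\tau\ge 0$ and every cyclic motion on $[0,\tau]$ along which $y_1(t)=\bar y_1$ is constant, $$\int_0^\tau \bar y_1^\top u_1(t)\,dt \ge 0 \quad\text{and}\quad \int_0^\tau y_2^\top(t)u_2(t)\,dt\ge 0 .$$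
   Context: The state is $x=(x_1,x_2)$, with $x_1\in\mathbb{R}^{n_1}$, $x_2\in\mathbb{R}^{n_2}$, ranging over a state space $\mathcal{X}$, an open subset of $\mathbb{R}^{n_1}\times\mathbb{R}^{n_2}$. The Hamiltonian $H:\mathcal{X}\to\mathbb{R}$ and the matrix-valued maps $J_1,J_2,R_1,R_2,G_2$ (of compatible sizes) are smooth. No lower bound on $H$ is assumed. The vectors $u_1,y_1$ are the input and output of port 1, and $u_2,y_2$ are the input and output of port 2. A cyclic motion on $[0,\tau]$ is a solution $x(t)=(x_1(t),x_2(t))$, $t\in[0,\tau]$, of the system for some input functions $u_1,u_2$ on $[0,\tau]$ such that $x(\tau)=x(0)$; the outputs $y_1(t),y_2(t)$ are those along this solution. *)

(* Defs.v *)
From HB Require Import structures.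
From mathcomp Require Import all_boot all_order all_algebra.
From mathcomp Require Import all_classical all_reals all_analysis.

Set Implicit Arguments.
Unset Strict Implicit.
Unset Printing Implicit Defensive.

Import Order.TTheory GRing.Theory Num.Theory.
Import numFieldNormedType.Exports.

Local Open Scope classical_set_scope.
Local Open Scope ring_scope.

(* For an open set X of a finite-dimensional space this is the usual class C^k:
   f is differentiable on X and all its directional derivatives are C^(k-1). *)
Fixpoint Ck (R : realType) (V W : normedModType R) (X : set V) (k : nat)
    (f : V -> W) : Prop :=
  match k with
  | 0 => forall x, X x -> {for x, continuous f}
  | k'.+1 => (forall x, X x -> differentiable f x) /\
             (forall v : V, Ck X k' (fun x => 'D_v f x))
  end.

Definition smooth_on (R : realType) (V W : normedModType R) (X : set V)
    (f : V -> W) : Prop :=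
  forall k : nat, Ck X k f.

(* Only the values of f on [a, b] matter; the intervals [l i, r i] of a family
   may share endpoints or be degenerate. *)
Definition abs_continuous (R : realType) (W : normedModType R) (a b : R)
    (f : R -> W) : Prop :=
  forall e : R, 0 < e -> exists2 d : R, 0 < d &
    forall (n : nat) (l r : 'I_n -> R),
      (forall i, a <= l i /\ l i <= r i /\ r i <= b) ->
      (forall i j, i != j -> r i <= l j \/ r j <= l i) ->
      \sum_(i < n) (r i - l i) < d ->
      \sum_(i < n) `|f (r i) - f (l i)| < e.

Section PartialDerivatives.
Variables (R : realType) (n1 n2 : nat).
Implicit Types (H : 'cV[R]_n1 * 'cV[R]_n2 -> R) (x : 'cV[R]_n1 * 'cV[R]_n2).

Definition pgrad1 H x : 'cV[R]_n1 :=
  \col_(i < n1) 'D_(delta_mx i 0) (fun z => H (z, x.2)) x.1.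

Definition pgrad2 H x : 'cV[R]_n2 :=
  \col_(i < n2) 'D_(delta_mx i 0) (fun z => H (x.1, z)) x.2.

Definition phess1 H x : 'M[R]_n1 :=
  \matrix_(i < n1, j < n1)
    'D_(delta_mx i 0) (fun z => pgrad1 H (z, x.2) j 0) x.1.

End PartialDerivatives.

(* The maps are total functions, but only their restrictions to [state_space] are
   constrained or used. *)
Record two_port (R : realType) (n1 n2 m2 : nat) := TwoPort {
  state_space : set ('cV[R]_n1 * 'cV[R]_n2);
  ham : 'cV[R]_n1 * 'cV[R]_n2 -> R;
  J1 : 'cV[R]_n1 * 'cV[R]_n2 -> 'M[R]_n1;
  J2 : 'cV[R]_n1 * 'cV[R]_n2 -> 'M[R]_n2;
  R1 : 'cV[R]_n1 * 'cV[R]_n2 -> 'M[R]_n1;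
  R2 : 'cV[R]_n1 * 'cV[R]_n2 -> 'M[R]_n2;
  G1 : 'M[R]_n1;
  G2 : 'cV[R]_n1 * 'cV[R]_n2 -> 'M[R]_(n2, m2)
}.

Section TwoPortSystem.
Variables (R : realType) (n1 n2 m2 : nat) (Sys : two_port R n1 n2 m2).
Implicit Types x : 'cV[R]_n1 * 'cV[R]_n2.

Definition smooth_system : Prop :=
  open (state_space Sys) /\ smooth_on (state_space Sys) (ham Sys) /\
  smooth_on (state_space Sys) (J1 Sys) /\ smooth_on (state_space Sys) (J2 Sys) /\
  smooth_on (state_space Sys) (R1 Sys) /\ smooth_on (state_space Sys) (R2 Sys) /\
  smooth_on (state_space Sys) (G2 Sys).

Definition skew_interconnection : Prop :=
  forall x, state_space Sys x -> J1 Sys x = - (J1 Sys x)^T /\ J2 Sys x = - (J2 Sys x)^T.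

Definition dissipative : Prop :=
  forall x, state_space Sys x ->
    (forall v : 'cV[R]_n1, 0 <= (v^T *m R1 Sys x *m v) 0 0) /\
    (forall v : 'cV[R]_n2, 0 <= (v^T *m R2 Sys x *m v) 0 0).

Definition e1 x : 'cV[R]_n1 := pgrad1 (ham Sys) x.
Definition e2 x : 'cV[R]_n2 := pgrad2 (ham Sys) x.

Definition y1 x : 'cV[R]_n1 := (G1 Sys)^T *m e1 x.
Definition y2 x : 'cV[R]_m2 := (G2 Sys x)^T *m e2 x.

Definition rhs1 x (u1 : 'cV[R]_n1) : 'cV[R]_n1 :=
  J1 Sys x *m e1 x - R1 Sys x *m e1 x + G1 Sys *m u1.
Definition rhs2 x (u2 : 'cV[R]_m2) : 'cV[R]_n2 :=
  J2 Sys x *m e2 x - R2 Sys x *m e2 x + G2 Sys x *m u2.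

(* Solutions in the sense of Caratheodory, for measurable inputs: this covers
   continuous and piecewise continuous inputs as well as L^p ones.  The a.e.
   condition is on the open interval so that the two-sided derivative does not
   involve values outside [0, tau]. *)
Record solution (tau : R) (x1 : R -> 'cV[R]_n1) (x2 : R -> 'cV[R]_n2)
    (u1 : R -> 'cV[R]_n1) (u2 : R -> 'cV[R]_m2) : Prop := Solution {
  sol_space : forall t : R, t \in `[0, tau] -> state_space Sys (x1 t, x2 t);
  sol_u1 : forall i, measurable_fun `[0, tau] (fun t => u1 t i 0);
  sol_u2 : forall i, measurable_fun `[0, tau] (fun t => u2 t i 0);
  sol_ac1 : abs_continuous 0 tau x1;
  sol_ac2 : abs_continuous 0 tau x2;
  sol_ode1 : {ae lebesgue_measure, forall t : R, t \in `]0, tau[ ->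
    is_derive t 1 x1 (rhs1 (x1 t, x2 t) (u1 t))};
  sol_ode2 : {ae lebesgue_measure, forall t : R, t \in `]0, tau[ ->
    is_derive t 1 x2 (rhs2 (x1 t, x2 t) (u2 t))}
}.

Definition cyclic_motion (tau : R) (x1 : R -> 'cV[R]_n1) (x2 : R -> 'cV[R]_n2)
    (u1 : R -> 'cV[R]_n1) (u2 : R -> 'cV[R]_m2) : Prop :=
  solution tau x1 x2 u1 u2 /\ x1 tau = x1 0 /\ x2 tau = x2 0.

End TwoPortSystem.

(* Main.v *)
(* Since G1 is invertible, e1 is constant along the motion, say e1 = e, so the
   supplied energies dominate derivatives of functions of the state: skewness of
   J_i and nonnegativity of R_i give
     ybar1^T u1 >= e^T x1' = (e^T x1)'   and
     y2^T u2 >= e2^T x2' = (H(x) - e^T x1)'   almost everywhere,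
   and both e^T x1 and H(x) - e^T x1 return to their initial value.  It remains
   to integrate these inequalities.  The integrands need not be integrable a
   priori; what is needed is that phi b - phi a is at most the integral of f
   whenever phi is absolutely continuous, f is measurable and phi' <= f almost
   everywhere. *)
Require Import Defs.
From mathcomp Require Import all_boot all_order all_algebra.
From mathcomp Require Import all_classical all_reals all_analysis.
From mathcomp Require Import measurable_realfun ring lra.
Import Order.TTheory GRing.Theory Num.Theory.
Import numFieldNormedType.Exports.
Local Open Scope classical_set_scope.
Local Open Scope ring_scope.

Set Implicit Arguments.
Unset Strict Implicit.
Unset Printing Implicit Defensive.

(** * Integration of derivatives of absolutely continuous functions *)

Section AbsoluteContinuity.
Variable R : realType.
Implicit Types (a b h d e K : R) (n : nat).

(** Removing elements one at a time lowers [#|S| * h] by [h <= d / 2], so the first value below [d]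
    is still at least [d / 2]. *)
Lemma ex_subset_card_itv (I : finType) (S : {set I}) h d :
  0 <= h -> h <= d / 2 -> d / 2 <= #|S|%:R * h -> 0 < d ->
  exists2 T : {set I}, T \subset S & d / 2 <= #|T|%:R * h < d.
Proof.
move=> h0 hd; elim: {S}_.+1 {-2}S (ltnSn #|S|) => // m IH S.
rewrite ltnS => Sm Sh d0.
have [Shd|Shd] := ltP (#|S|%:R * h) d; first by exists S => //; rewrite Sh.
have [S0|[x xS]] := set_0Vmem S.
  by move: Shd; rewrite S0 cards0 mul0r leNgt d0.
have cS : #|S| = #|S :\ x|.+1 by rewrite (cardsD1 x) xS.
have [|||T TS Th] := IH (S :\ x) => //.
- by rewrite -ltnS -cS.
- have : d <= #|S :\ x|.+1%:R * h by rewrite -cS.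
  by rewrite -natr1 mulrDl mul1r; move: (_ * h) => c; lra.
by exists T => //; rewrite (fintype.subset_trans TS) ?finset.subsetDl.
Qed.

(** The mesh cells selected by [A] form an admissible family for [abs_continuous], of total length
    [#|A| * h]. *)
Lemma abs_continuous_sum_partition (W : normedModType R) a b (f : R -> W) :
  abs_continuous a b f -> forall e, 0 < e -> exists2 d, 0 < d &
  forall n h (A : {set 'I_n}), 0 <= h -> a + n%:R * h <= b -> #|A|%:R * h < d ->
    \sum_(i in A) `|f (a + i.+1%:R * h) - f (a + i%:R * h)| < e.
Proof.
move=> fac e /fac[d d0 fd]; exists d => // n h A h0 nhb Ah.
have mono (i j : nat) : (i <= j)%N -> a + i%:R * h <= a + j%:R * h.
  by move=> ij; rewrite lerD2l ler_wpM2r// ler_nat.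
rewrite big_enum_val /=.
apply: (fd #|A| (fun k => a + (enum_val k)%:R * h)
                (fun k => a + (enum_val k).+1%:R * h)).
- move=> i; split; first by rewrite lerDl mulr_ge0.
  by split; [exact: mono|exact: le_trans (mono _ _ (ltn_ord _)) nhb].
- move=> i j ij.
  have : (enum_val i : nat) != enum_val j.
    by apply: contra_neq ij => /ord_inj/enum_val_inj.
  by rewrite neq_ltn => /orP[] /mono; [left|right].
- rewrite (eq_bigr (fun=> h)) => [|i _]; last first.
    by rewrite -natr1; ring.
  by rewrite sumr_const card_ord -mulr_natl.
Qed.

(* Were the increments steeper than K carried by total length at least d, some
   of them would carry a length in [d/2, d[, and sum up to K d/2 = e or more. *)
Lemma abs_continuous_sum_steep a b (f : R -> R) : a < b ->
  abs_continuous a b f -> forall e, 0 < e -> exists2 K, 0 <= K &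
  \forall n \near \oo, let h := (b - a) / n.+1%:R in
    \sum_(i < n.+1) Num.max 0 (K * h - (f (a + i.+1%:R * h) - f (a + i%:R * h)))
      <= K * (b - a) - (f b - f a) + e.
Proof.
move=> ab /abs_continuous_sum_partition fac e e0.
have [d d0 fd] := fac _ e0.
pose K := 2 * e / d; have K0 : 0 <= K by rewrite divr_ge0 ?mulr_ge0// ltW.
exists K => //.
have : \forall n \near \oo, (b - a) / n.+1%:R <= d / 2.
  apply: (@cvgr_le R _ _ _ (fun n : nat => (b - a) * harmonic n) 0);
    last by rewrite divr_gt0.
  rewrite -(mulr0 (b - a)); apply: cvgMr; exact: cvg_harmonic.
apply: filterS => n hd /=; set h := (b - a) / _ in hd *.
have h0 : 0 <= h by rewrite divr_ge0 // subr_ge0 ltW.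
have nh : n.+1%:R * h = b - a by rewrite /h mulrC divfK.
pose D (i : nat) := f (a + i.+1%:R * h) - f (a + i%:R * h).
pose S := [set i : 'I_n.+1 | K * h < D i]%SET.
have Sd : #|S|%:R * h < d.
  rewrite ltNge; apply/negP => dS.
  have [||T /fintype.subsetP TS /andP[dT Td]] :=
    @ex_subset_card_itv _ S h d h0 hd => //.
    by apply: le_trans dS; lra.
  have := fd n.+1 h T h0; rewrite nh subrKC => /(_ (lexx _) Td).
  apply/negP; rewrite -leNgt.
  apply: (@le_trans _ _ (\sum_(i in T) K * h)); last first.
    by apply: ler_sum => i /TS; rewrite inE => /ltW KD;
      apply: le_trans KD (ler_norm _).
  rewrite sumr_const -mulr_natl mulrCA.
  rewrite /K; apply: le_trans (ler_wpM2l K0 dT).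
  by rewrite /K le_eqVlt; apply/orP; left; apply/eqP; field; rewrite gt_eqF.
have SD : \sum_(i in S) `|D i| <= e.
  by apply/ltW/(fd n.+1 h S h0) => //; rewrite nh subrKC.
have tel : \sum_(i < n.+1) D i = f b - f a.
  rewrite -(big_mkord xpredT D) telescope_sumr// mul0r addr0 nh.
  by rewrite subrKC.
(* The truncation exceeds [K * h - D i] only on [S], by [D i - K * h <= |D i|]; these excesses sum
   to at most [e], and the rest telescopes. *)
apply: (@le_trans _ _
  (\sum_(i < n.+1) (K * h - D i + (if i \in S then `|D i| else 0)))).
  apply: ler_sum => i _; rewrite -/(D i) inE.
  have Kh0 : 0 <= K * h by exact: mulr_ge0.
  case: ltP => DK; rewrite ge_max.
    by move: (ler_norm (D i)) (normr_ge0 (D i)) => *; apply/andP; split; lra.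
  by rewrite addr0 lexx andbT subr_ge0.
rewrite big_split /= sumrB tel -big_mkcond /= sumr_const card_ord.
by rewrite -mulr_natl mulrCA nh lerD2l.
Qed.

End AbsoluteContinuity.

(** * Step functions on a uniform mesh and passage to the limit *)

Section KeyLemma.
Variable R : realType.
Implicit Types (a b h d e K t : R) (n : nat) (c : nat -> R).

(** Half-open cells are disjoint, so at most one term is nonzero at each point. *)
Definition step_fun a h n c t : R :=
  \sum_(i < n) c i * \1_`[a + i%:R * h, a + i.+1%:R * h[ t.

Lemma step_funE a h n c t (j : nat) : 0 < h -> (j < n)%N ->
  a + j%:R * h <= t -> t < a + j.+1%:R * h -> step_fun a h n c t = c j.
Proof.
move=> h0 jn jt tj; rewrite /step_fun (bigD1 (Ordinal jn))//= big1 ?addr0.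
  by rewrite indicE mem_set ?mulr1//= in_itv/= jt.
move=> i ij; rewrite indicE memNset ?mulr0//= in_itv/= => /andP[it ti].
move/eqP: ij; apply; apply/val_inj/eqP => /=.
have ltn_mesh (k l : nat) : a + k%:R * h < a + l.+1%:R * h -> (k <= l)%N.
  by rewrite ltrD2l ltr_pM2r// ltr_nat ltnS.
by rewrite eqn_leq !ltn_mesh// ?(le_lt_trans jt) ?(le_lt_trans it).
Qed.

Lemma measurable_step_fun (D : set R) a h n c : measurable D ->
  measurable_fun D (step_fun a h n c).
Proof.
move=> mD; apply: measurable_sum => i; apply: measurable_funM => //.
Qed.

Lemma integral_step_fun a b h n c : 0 <= h -> a + n%:R * h <= b ->
  (forall i, 0 <= c i) ->
  (\int[lebesgue_measure]_(t in `[a, b]) (step_fun a h n c t)%:E)%E =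
  (\sum_(i < n) h * c i)%:E.
Proof.
move=> h0 nhb c0.
under eq_integral do rewrite /step_fun -sumEFin.
rewrite ge0_integral_sum//=; last 2 first.
- move=> i; apply/measurable_EFinP; apply: measurable_funM => //.
- by move=> i t _; rewrite lee_fin mulr_ge0.
rewrite -sumEFin; apply: eq_bigr => i _.
have ih : a + i%:R * h <= a + i.+1%:R * h by rewrite lerD2l ler_wpM2r// ler_nat.
under eq_integral do rewrite EFinM.
rewrite ge0_integralZl//=; last 2 first.
- by apply/measurable_EFinP; exact: measurable_indic.
- by rewrite lee_fin.
rewrite integral_indic//= setIidl; last first.
  move=> t /=; rewrite !in_itv/= => /andP[it ti]; apply/andP; split.
    by apply: le_trans it; rewrite lerDl mulr_ge0.
  by apply: (le_trans (ltW ti)); apply: le_trans nhb;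
    rewrite lerD2l ler_wpM2r// ler_nat.
rewrite lebesgue_measure_itv/= lte_fin -EFinD muleC.
case: ltP => [_|hi]; first by rewrite -EFinM; congr (_ * _)%:E; rewrite -natr1; ring.
have -> : h = 0.
  apply/eqP; move: ih hi; rewrite -natr1 => *.
  by rewrite eq_le; apply/andP; split; lra.
by rewrite mul0e mul0r.
Qed.

(** Split [f r - f l] at [t]: each part is linear up to [e] times its length, and since [t] lies
    between [l] and [r] the two lengths add up to [r - l]. *)
Lemma is_derive_straddle (f : R -> R) t (v : R) : is_derive t 1 f v ->
  forall e, 0 < e -> exists2 d, 0 < d &
  forall l r, l <= t -> t <= r -> l < r -> r - l < d ->
    `|(f r - f l) / (r - l) - v| <= e.
Proof.
move=> [dft <-] e e0.
have : h^-1 *: (f (h *: 1 + t) - f t) @[h --> 0^'] --> 'D_1 f t by exact: dft.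
move=> /cvgrPdist_le /(_ _ e0).
rewrite near_withinE => /nbhs_ballP[d /= d0 fd]; exists d => // l r lt tr lr rld.
(* Clearing the denominator makes the estimate valid at [s = t] too, which covers [l = t] and
   [r = t]. *)
have key s : `|s - t| < d -> `|f s - f t - (s - t) * 'D_1 f t| <= e * `|s - t|.
  have [->|st] := eqVneq s t; first by rewrite !subrr mul0r subr0 normr0 mulr0.
  rewrite -subr_eq0 in st => std.
  have /= := fd (s - t); rewrite /ball/= sub0r normrN => /(_ std st).
  rewrite scaler1 subrK -[_ *: (_ - _)]/(_ * _) distrC => H.
  rewrite -ler_pdivrMr ?normr_gt0// -normfV -normrM.
  by rewrite mulrBl (mulrC (_ - _) ('D_1 f t)) mulfK// mulrC.
have rl0 : 0 < r - l by rewrite subr_gt0.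
have -> : (f r - f l) / (r - l) - 'D_1 f t =
  ((f r - f t - (r - t) * 'D_1 f t) - (f l - f t - (l - t) * 'D_1 f t)) / (r - l).
  by field; rewrite gt_eqF.
rewrite normrM normfV (gtr0_norm rl0) ler_pdivrMr//.
apply: (le_trans (ler_normB _ _)).
have /key kr : `|r - t| < d by rewrite ger0_norm ?subr_ge0//; lra.
have /key kl : `|l - t| < d by rewrite ler0_norm ?subr_le0//; lra.
move: kr kl; rewrite (ger0_norm (_ : 0 <= r - t)) ?subr_ge0//.
rewrite (ler0_norm (_ : l - t <= 0)) ?subr_le0// => kr kl.
apply: le_trans (lerD kr kl) _.
by rewrite -mulrDr le_eqVlt; apply/orP; left; apply/eqP; congr (_ * _); ring.
Qed.



Lemma le_maxr0_dist (x y : R) : `|Num.max 0 x - Num.max 0 y| <= `|x - y|.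
Proof.
by rewrite /Num.max; do 2!case: ifP => ?; rewrite ler_norml;
  move: (ler_norm (x - y)) (ler_norm (- (x - y))); rewrite normrN => *;
  apply/andP; split; lra.
Qed.

(** The endpoints of the cell containing [t] straddle [t], so the value of the step function there
    comes from a difference quotient tending to [v]. *)
Lemma cvg_step_fun_derive a b (f : R -> R) K t v :
  t \in `]a, b[ -> is_derive t 1 f v ->
  (fun n => let h := (b - a) / n.+1%:R in step_fun a h n.+1 (fun i =>
      Num.max 0 (K - (f (a + i.+1%:R * h) - f (a + i%:R * h)) / h)) t)
    @ \oo --> Num.max 0 (K - v).
Proof.
rewrite in_itv/= => /andP[at_ tb] /is_derive_straddle fv.
have ba0 : 0 < b - a by rewrite subr_gt0; exact: lt_trans tb.
apply/cvgrPdist_le => e /fv[d d0 {}fv].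
have : \forall n \near \oo, (b - a) / n.+1%:R < d.
  apply: (@cvgr_lt R _ _ _ (fun n : nat => (b - a) * harmonic n) 0) => //.
  by rewrite -(mulr0 (b - a)); apply: cvgMr; exact: cvg_harmonic.
apply: filterS => n; set h := (b - a) / _ => hd /=.
have h0 : 0 < h by rewrite divr_gt0.
have nh : n.+1%:R * h = b - a by rewrite /h mulrC divfK.
pose j := Num.trunc ((t - a) / h).
have /andP[jt tj] : j%:R <= (t - a) / h < j.+1%:R.
  by apply: truncn_itv; rewrite divr_ge0 ?subr_ge0// ltW.
rewrite ler_pdivlMr// lerBrDl in jt.
rewrite ltr_pdivrMr// ltrBlDl in tj.
rewrite (@step_funE _ _ _ _ _ j)//; last first.
  have : j%:R * h < n.+1%:R * h by rewrite nh; lra.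
  by rewrite ltr_pM2r// ltr_nat.
have hE : a + j.+1%:R * h - (a + j%:R * h) = h by rewrite -natr1; ring.
apply: le_trans (le_maxr0_dist _ _) _.
set q := _ / h.
have -> : K - v - (K - q) = q - v by ring.
by rewrite /q -[X in _ / X]hE; apply: fv; rewrite ?hE// ?ltW// (le_lt_trans jt).
Qed.

Lemma le_limn_einf (u : (\bar R)^nat) (l : \bar R) :
  (\forall n \near \oo, (u n <= l)%E) -> (limn_einf u <= l)%E.
Proof.
move=> ul; rewrite limn_einf_lim; apply: lime_le; first exact: is_cvg_einfs.
by apply: filterS ul => n; apply: le_trans; apply: ereal_inf_lbound; exists n => /=.
Qed.

Lemma filter_lebesgue_ae :
  Filter (almost_everywhere (@lebesgue_measure R : set R -> \bar R)).
Proof.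
exact: (ae_filter_ringOfSetsType
  (lebesgue_measure : {measure set (measurableTypeR R) -> \bar R})).
Qed.

Lemma limn_einf_ge0 (u : (\bar R)^nat) :
  (forall n, 0 <= u n)%E -> (0 <= limn_einf u)%E.
Proof.
move=> u0; rewrite limn_einf_lim; apply: lime_ge; first exact: is_cvg_einfs.
by apply: nearW => n; apply: le_ereal_inf_tmp => _ [m _ <-].
Qed.

(** The lower limit is minus the upper limit of the opposites. *)
Lemma measurable_limn_einf (disp : measure_display) (T : measurableType disp)
    (D : set T) (u : (T -> \bar R)^nat) :
  (forall n, measurable_fun D (u n)) ->
  measurable_fun D (fun x => limn_einf (u ^~ x)).
Proof.
move=> mu; apply: (measurableT_comp (@oppe_measurable R setT)).
apply: (measurable_fun_limn_esup (f := fun n x => (- u n x)%E)) => n.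
exact: (measurableT_comp (@oppe_measurable R setT)).
Qed.

(** Positive and negative parts are compared separately, so the integral of [g] may be infinite. *)
Lemma le_integral_integrable_l (disp : measure_display) (T : measurableType disp)
    (mu : {measure set T -> \bar R}) (D : set T) (f g : T -> \bar R) :
  measurable D -> mu.-integrable D f -> measurable_fun D g ->
  (forall x, D x -> (f x <= g x)%E) ->
  (\int[mu]_(x in D) f x <= \int[mu]_(x in D) g x)%E.
Proof.
move=> mD fint mg fg; have mf := measurable_int _ fint.
have fg' : {in D, forall x, (f x <= g x)%E} by move=> x /set_mem/fg.
rewrite (integralE _ _ f) (integralE _ _ g); apply: leeB.
  apply: ge0_le_integral => //;
    [exact: measurable_funepos|exact: measurable_funepos|].
  by move=> x Dx; apply: (funepos_le fg'); rewrite inE.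
apply: ge0_le_integral => //;
    [exact: measurable_funeneg|exact: measurable_funeneg|].
by move=> x Dx; apply: (funeneg_le fg'); rewrite inE.
Qed.

(* Fatou's lemma applied to the truncated difference quotients
   [max 0 (K - Df/h)] bounds the integral of [max 0 (K - g)]. *)
Lemma abs_continuous_le_integral a b (f g : R -> R) : a <= b ->
  abs_continuous a b f -> measurable_fun `[a, b] g ->
  {ae lebesgue_measure, forall t : R, t \in `]a, b[ ->
    derivable f t 1 /\ 'D_1 f t <= g t} ->
  ((f b - f a)%:E <= \int[lebesgue_measure]_(t in `[a, b]) (g t)%:E)%E.
Proof.
rewrite le_eqVlt => /predU1P[<- _ _ _|ab fac mg dfg].
  by rewrite subrr set_itv1 integral_set1.
apply/lee_addgt0Pr => e e0.
have [K K0 Kfe] := abs_continuous_sum_steep ab fac e0.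
have mgo : measurable_fun `]a, b[ g.
  by apply: measurable_funS mg => //; exact: subset_itv_oo_cc.
have mgco : measurable_fun `[a, b[ g.
  by apply: measurable_funS mg => //; exact: subset_itv_co_cc.
pose P t := Num.max 0 (K - g t).
have mP (D : set R) : measurable_fun D g -> measurable_fun D P.
  by move=> mDg; apply: measurable_maxr => //; exact: measurable_funB.
pose h n := (b - a) / n.+1%:R.
have h0 n : 0 < h n by rewrite divr_gt0 ?subr_gt0.
have nh n : n.+1%:R * h n = b - a by rewrite /h mulrC divfK.
pose c n i := Num.max 0 (K - (f (a + i.+1%:R * h n) - f (a + i%:R * h n)) / h n).
have c0 n i : 0 <= c n i by rewrite le_max lexx.
pose F n t := step_fun a (h n) n.+1 (c n) t.
have F0 n t : 0 <= F n t by apply: sumr_ge0 => i _; rewrite mulr_ge0.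
have mF (D : set R) n : measurable D -> measurable_fun D (F n).
  exact: measurable_step_fun.
pose B := K * (b - a) - (f b - f a) + e.
(* The endpoints are discarded because the bound on the derivative is known only inside the
   interval. *)
have PB : (\int[lebesgue_measure]_(t in `[a, b]) (P t)%:E <= B%:E)%E.
  rewrite -integral_itv_bndo_bndc; last first.
    by apply/measurable_EFinP; exact: mP.
  rewrite -integral_itv_obnd_cbnd; last first.
    by apply/measurable_EFinP; exact: mP.
  apply: (@le_trans _ _ (\int[lebesgue_measure]_(t in `]a, b[)
      limn_einf (fun n => (F n t)%:E))%E).
    apply: ae_ge0_le_integral => //.
    - by move=> t _; rewrite lee_fin le_max lexx.
    - by apply/measurable_EFinP; exact: mP.
    - by move=> t _; apply: limn_einf_ge0 => n; rewrite lee_fin.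
    - apply: measurable_limn_einf => n.
      by apply/measurable_EFinP; exact: mF.
    (* Almost everywhere [F n t] tends to [max 0 (K - f'(t))], which dominates [P t] because
       [f' <= g]. *)
    - apply: (@filterS _ _ filter_lebesgue_ae) dfg => t dft tab;
      have [/derivableP dfv vg] := dft tab.
      have Ft := cvg_step_fun_derive (K := K) tab dfv.
      have /cvg_limn_einf_sup[-> _] :
          (F n t)%:E @[n --> \oo] --> (Num.max 0 (K - 'D_1 f t))%:E.
        by apply: cvg_EFin; [exact: nearW|exact: Ft].
      by rewrite lee_fin ge_max !le_max lexx lerD2l lerN2 vg orbT.
  apply: le_trans (fatou _ _ _ _) _ => //.
  - by move=> n; apply/measurable_EFinP; exact: mF.
  - by move=> n t _; rewrite lee_fin.
  apply: le_limn_einf; apply: filterS Kfe => n /= Kfe.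
  apply: (@le_trans _ _ (\int[lebesgue_measure]_(t in `[a, b]) (F n t)%:E)%E).
    apply: ge0_subset_integral => //; first by apply/measurable_EFinP; exact: mF.
    by move=> t _; rewrite lee_fin.
    exact: subset_itv_oo_cc.
  (* Multiplying by [h n] turns each [c n i] into the truncated increment bounded in [Kfe]. *)
  rewrite (integral_step_fun (ltW (h0 n)) _ (c0 n)) ?nh ?subrKC// lee_fin.
  apply: le_trans Kfe; apply: ler_sum => i _; rewrite -/(h n) /c.
  rewrite maxr_pMr; last exact: ltW (h0 n).
  by rewrite mulr0 mulrBr (mulrC K) [_ * (_ / _)]mulrC divfK ?gt_eqF.
have Pint : lebesgue_measure.-integrable `[a, b] (EFin \o P).
  apply/integrableP; split; first by apply/measurable_EFinP; exact: mP.
  apply: le_lt_trans (ltry B); apply: le_trans PB; rewrite le_eqVlt.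
  apply/orP; left; apply/eqP; apply: eq_integral => t _ /=.
  by rewrite ger0_norm// le_max lexx.
have Kint : lebesgue_measure.-integrable `[a, b] (EFin \o cst K).
  by apply: continuous_compact_integrable; [exact: segment_compact|
    apply: continuous_subspaceT => x; exact: cst_continuous].
(* Since [K - P <= g], the integral of [g] is at least [K * (b - a) - B], which is
   [f b - f a - e]. *)
have -> : (f b - f a)%:E = ((K * (b - a))%:E - B%:E + e%:E)%E.
  by rewrite -EFinB -EFinD; congr _%:E; rewrite /B; ring.
rewrite leeD2r//; apply: (@le_trans _ _
  (\int[lebesgue_measure]_(t in `[a, b]) ((K)%:E - (P t)%:E))%E).
  rewrite integralB_EFin//.
  rewrite integral_cst//= lebesgue_measure_itv/= lte_fin ab.
  by rewrite -EFinD -EFinM EFinB; exact: leeB.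
apply: le_integral_integrable_l => //.
- exact: integrableB.
- exact/measurable_EFinP.
- move=> t _; rewrite -EFinB lee_fin lerBlDr -lerBlDl le_max.
  by rewrite lexx orbT.
Qed.
End KeyLemma.

(** * Composition of a C^1 function with an absolutely continuous path *)

Section Lipschitz.
Variable R : realType.

(** The ball is convex, so the mean value theorem applies to [f] on the segment from [q] to [q']. *)
Lemma lipschitz_on_ball (V : normedModType R) (f : V -> R) (p : V) (e C : R) :
  (forall q, ball p e q -> differentiable f q /\ forall v, `|'d f q v| <= C * `|v|) ->
  forall q q', ball p e q -> ball p e q' -> `|f q' - f q| <= C * `|q' - q|.
Proof.
move=> df q q' pq pq'; set w := q' - q.
have seg (s : R) : s \in `[0, 1] -> ball p e (q + s *: w).
  rewrite in_itv/= => /andP[s0 s1].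
  move: pq pq'; rewrite -ball_normE/= => pq pq'.
  have -> : p - (q + s *: w) = (1 - s) *: (p - q) + s *: (p - q').
    rewrite scalerBl scale1r -addrA [- _ + _]addrC -scalerBr opprD addrA -scalerN.
    by congr (_ + _ *: _); rewrite /w !opprB [RHS]addrC addrA subrK.
  apply: (le_lt_trans (ler_normD _ _)); rewrite !normrZ ger0_norm ?subr_ge0//.
  (* Strictness comes from the weight [1 - s], so [s = 1] is treated apart. *)
  rewrite ger0_norm//; have [->|s1'] := eqVneq s 1.
    by rewrite subrr mul0r add0r mul1r.
  have : (1 - s) * `|p - q| < (1 - s) * e.
    by rewrite ltr_pM2l// subr_gt0 lt_neqAle s1'.
  have : s * `|p - q'| <= s * e by rewrite ler_wpM2l// ltW.
  by move: (_ * `|p - q|) (s * `|p - q'|) => x y; lra.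
have dphi (s : R) : s \in `[0, 1] ->
    is_derive s 1 (fun r : R => f (q + r *: w)) ('d f (q + s *: w) w).
  move=> /seg/df[dfs _].
  have dg : is_diff s (fun r : R => q + r *: w) (fun r => r *: w).
    apply: is_diff_eq (is_diffD (is_diff_cst q s) (is_diff_scalel s w)) _.
    by rewrite add0r.
  have dfd : is_diff (q + s *: w) f ('d f (q + s *: w)) by exact: DiffDef.
  have [ex val] := is_diff_comp dg dfd.
  apply: DeriveDef; first exact: diff_derivable ex.
  by rewrite deriveE// val /= scale1r.
have [|c c01] := @MVT_segment R _ _ 0 1 ler01
  (fun s s01 => dphi s (subset_itv_oo_cc s01)).
- by apply: derivable_within_continuous => s s01; have [] := dphi _ s01.
rewrite scale0r scale1r addr0 subr0 mulr1 subrKC => ->.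
by have [_] := df _ (seg _ c01); apply.
Qed.

(** * Partial gradients and local Lipschitz bounds on a product space *)

Section Pairs.
Variables (n1 n2 : nat).
Implicit Types (p : 'cV[R]_n1 * 'cV[R]_n2) (H : 'cV[R]_n1 * 'cV[R]_n2 -> R).

Lemma ler_norm_coord m (v : 'cV[R]_m) (i : 'I_m) : `|v i 0| <= `|v|.
Proof.
rewrite [leRHS]/Num.Def.normr/= mx_normrE.
exact: (le_bigmax 0 (fun ij : 'I_m * 'I_1 => `|v ij.1 ij.2|) (i, ord0)).
Qed.

(** Both sides are limits of the same difference quotient. This links the partial gradients to the
    directional derivatives in [Ck]. *)
Lemma derive_pgrad1 H p i : pgrad1 H p i 0 = 'D_(delta_mx i 0, 0) H p.
Proof.
case: p => p1 p2; rewrite mxE /derive /=.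
have E (h : R) : h *: (delta_mx i 0, 0) + (p1, p2) = (h *: delta_mx i 0 + p1, p2).
  by congr (_, _); rewrite /= scaler0 add0r.
by under [in RHS]eq_fun do rewrite E.
Qed.

Lemma derive_pgrad2 H p i : pgrad2 H p i 0 = 'D_(0, delta_mx i 0) H p.
Proof.
case: p => p1 p2; rewrite mxE /derive /=.
have E (h : R) : h *: (0, delta_mx i 0) + (p1, p2) = (p1, h *: delta_mx i 0 + p2).
  by congr (_, _); rewrite /= scaler0 add0r.
by under [in RHS]eq_fun do rewrite E.
Qed.

Lemma diff_pgrad H p v : differentiable H p ->
  'd H p v = \sum_i v.1 i 0 * pgrad1 H p i 0 + \sum_i v.2 i 0 * pgrad2 H p i 0.
Proof.
move=> dH.
have col m (u : 'cV[R]_m) : u = \sum_i u i 0 *: delta_mx i 0.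
  by rewrite {1}[u]matrix_sum_delta; apply: eq_bigr => i _; rewrite big_ord1.
have -> : 'd H p v = 'd H p (v.1, 0) + 'd H p (0, v.2).
  by rewrite -raddfD; congr ('d H p _); case: v => a b; congr (_, _);
    rewrite /= ?addr0 ?add0r.
congr (_ + _).
  rewrite {1}[v.1]col (big_morph (fun a => 'd H p (a, 0)) (id1 := 0) (op1 := +%R)).
  - apply: eq_bigr => i _; rewrite derive_pgrad1 deriveE// -[RHS]linearZ.
    by congr ('d H p _); congr (_, _); rewrite /= scaler0.
  - by move=> a b; rewrite -raddfD; congr ('d H p _); congr (_, _); rewrite /= addr0.
  - exact: (raddf0 ('d H p)).
rewrite {1}[v.2]col (big_morph (fun a => 'd H p (0, a)) (id1 := 0) (op1 := +%R)).
- apply: eq_bigr => i _; rewrite derive_pgrad2 deriveE// -[RHS]linearZ.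
  by congr ('d H p _); congr (_, _); rewrite /= scaler0.
- by move=> a b; rewrite -raddfD; congr ('d H p _); congr (_, _); rewrite /= addr0.
- exact: (raddf0 ('d H p)).
Qed.

(** The partial derivatives are continuous, so near [p] each is at most its absolute value at [p]
    plus 1. The norm being the max norm, the sum [C] of these bounds controls the differential. *)
Lemma Ck1_locally_lipschitz (X : set ('cV[R]_n1 * 'cV[R]_n2)) H p :
  open X -> Ck X 1 H -> X p -> exists C e, [/\ 0 <= C, 0 < e &
  forall q q', ball p e q -> ball p e q' -> `|H q' - H q| <= C * `|q' - q|].
Proof.
move=> oX [dH cH] Xp.
pose M1 i := `|pgrad1 H p i 0| + 1; pose M2 i := `|pgrad2 H p i 0| + 1.
pose C := \sum_i M1 i + \sum_i M2 i.
have near1 : \forall q \near p, forall i, `|pgrad1 H q i 0| <= M1 i.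
  apply: (@filter_forall _ _ (fun i q => `|pgrad1 H q i 0| <= M1 i) _ (nbhs_filter p)) => i.
  under eq_near do rewrite derive_pgrad1.
  by apply: (cvgr_norm_le ('D_(delta_mx i 0, 0) H p)); [exact: cH|
    rewrite /M1 derive_pgrad1 ltrDl].
have near2 : \forall q \near p, forall i, `|pgrad2 H q i 0| <= M2 i.
  apply: (@filter_forall _ _ (fun i q => `|pgrad2 H q i 0| <= M2 i) _ (nbhs_filter p)) => i.
  under eq_near do rewrite derive_pgrad2.
  by apply: (cvgr_norm_le ('D_(0, delta_mx i 0) H p)); [exact: cH|
    rewrite /M2 derive_pgrad2 ltrDl].
have nearX : \forall q \near p, X q by exact: open_nbhs_nbhs.
have : nbhs p (X `&` ([set q | forall i, `|pgrad1 H q i 0| <= M1 i] `&`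
    [set q | forall i, `|pgrad2 H q i 0| <= M2 i])).
  by apply: filterI => //; exact: filterI.
move=> /nbhs_ballP[e /= e0 He].
exists C, e; split=> //.
  by rewrite addr_ge0// sumr_ge0// => i _; rewrite addr_ge0.
apply: lipschitz_on_ball => q /He[Xq [M1q M2q]]; split; first exact: dH.
move=> v; rewrite diff_pgrad; last exact: dH.
rewrite /C mulrDl; apply: (le_trans (ler_normD _ _)); rewrite !mulr_suml.
apply: lerD; apply: (le_trans (ler_norm_sum _ _ _)); apply: ler_sum => i _.
- rewrite normrM mulrC ler_pM//; apply: (le_trans (ler_norm_coord _ _)).
  by rewrite prod_normE le_max lexx.
- rewrite normrM mulrC ler_pM//; apply: (le_trans (ler_norm_coord _ _)).
  by rewrite prod_normE le_max lexx orbT.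
Qed.

End Pairs.
End Lipschitz.

(** * Absolutely continuous paths *)

Section Paths.
Variable R : realType.
Implicit Types a b : R.

(** A family of one interval: uniform continuity. *)
Lemma abs_continuousW (V : normedModType R) a b (x : R -> V) :
  abs_continuous a b x -> forall e, 0 < e -> exists2 d, 0 < d &
  forall s t, s \in `[a, b] -> t \in `[a, b] -> `|s - t| < d -> `|x s - x t| < e.
Proof.
move=> acx e /acx[d d0 xd]; exists d => // s t.
wlog st : s t / s <= t.
  move=> wl sab tab; have /orP[/wl|/wl H] := le_total s t; first exact.
  by rewrite distrC [`|x s - _|]distrC; exact: H.
rewrite !in_itv/= => /andP[as_ sb] /andP[at_ tb] std.
have := xd 1%N (fun=> s) (fun=> t); rewrite !big_ord1 distrC; apply.
- by move=> _; split.
- by move=> i j; rewrite !ord1 eqxx.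
- by move: std; rewrite distrC ger0_norm// subr_ge0.
Qed.

Lemma abs_continuous_continuous (V : normedModType R) a b (x : R -> V) :
  abs_continuous a b x -> {within `[a, b], continuous x}.
Proof.
move=> /abs_continuousW acx; apply/subspace_continuousP => t tab.
apply/cvgrPdist_lt => e /acx[d d0 xd].
rewrite near_withinE; apply/nbhs_ballP; exists d => //= s std sab.
by apply: xd => //; rewrite distrC.
Qed.

Lemma abs_continuous_pair (V W : normedModType R) a b (x : R -> V) (y : R -> W) :
  abs_continuous a b x -> abs_continuous a b y ->
  abs_continuous a b (fun t => (x t, y t)).
Proof.
move=> acx acy e e0; have e20 : 0 < e / 2 by rewrite divr_gt0.
have [d d0 xd] := acx _ e20; have [d' d'0 yd] := acy _ e20.
exists (Num.min d d'); first by rewrite lt_min d0.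
move=> n l r lr disj; rewrite lt_min => /andP[nd nd'].
apply: (@le_lt_trans _ _ (\sum_(i < n) (`|x (r i) - x (l i)| + `|y (r i) - y (l i)|))).
  apply: ler_sum => i _; rewrite prod_normE /= ge_max.
  by rewrite lerDl lerDr !normr_ge0.
by rewrite big_split/= [e]splitr ltrD// ?xd ?yd.
Qed.

(** A bound for nearby times suffices: in a family of total length below [d], every interval is
    shorter than [d]. *)
Lemma abs_continuous_le_dist (V W : normedModType R) a b (x : R -> V)
    (y : R -> W) (C d : R) : 0 < d -> abs_continuous a b x ->
  (forall s t, s \in `[a, b] -> t \in `[a, b] -> `|t - s| < d ->
    `|y t - y s| <= C * `|x t - x s|) -> abs_continuous a b y.
Proof.
(* [K] is positive and at least [C], whatever the sign of [C]. *)
move=> d0 acx yx e e0; pose K := `|C| + 1.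
have K0 : 0 < K by rewrite ltr_wpDl.
have [d' d'0 xd] := acx (e / K) (divr_gt0 e0 K0).
exists (Num.min d d'); first by rewrite lt_min d0.
move=> n l r lr disj; rewrite lt_min => /andP[nd nd'].
have := xd n l r lr disj nd'; rewrite ltr_pdivlMr// mulrC mulr_sumr.
apply: le_lt_trans; apply: ler_sum => i _; have [al [li rb]] := lr i.
apply: (@le_trans _ _ (C * `|x (r i) - x (l i)|)).
  apply: yx; rewrite ?in_itv/= ?al ?rb ?(le_trans al) ?(le_trans li)//.
  rewrite ger0_norm ?subr_ge0//; apply: le_lt_trans nd.
  rewrite (bigD1 i)//= lerDl; apply: sumr_ge0 => j _.
  by have [_ [lj _]] := lr j; rewrite subr_ge0.
by rewrite ler_wpM2r// (le_trans (ler_norm _))// lerDl.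
Qed.

(** Compactness makes the local constants uniform. A single parameter [C] tending to infinity serves
    both as Lipschitz constant and, inverted, as time radius. *)
Lemma lipschitz_along_path (V : normedModType R) a b (x : R -> V) (f : V -> R) :
  {within `[a, b], continuous x} ->
  (forall t, t \in `[a, b] -> exists C e, [/\ 0 <= C, 0 < e &
    forall q q', ball (x t) e q -> ball (x t) e q' ->
      `|f q' - f q| <= C * `|q' - q|]) ->
  exists2 C, 0 < C & forall s t, s \in `[a, b] -> t \in `[a, b] ->
    `|t - s| < C^-1 -> `|f (x t) - f (x s)| <= C * `|x t - x s|.
Proof.
move=> /subspace_continuousP xc floc.
have /compact_near_coveringP cov := @segment_compact R a b.
pose P (C s : R) := s \in `[a, b] -> forall t, t \in `[a, b] ->
  `|t - s| < C^-1 -> `|f (x t) - f (x s)| <= C * `|x t - x s|.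
have : \forall C \near +oo, `[a, b] `<=` P C.
  apply: cov => t tab; have [C0 [e [C00 e0 fe]]] := floc _ tab.
  have := xc _ tab; move=> /cvgrPdist_lt /(_ _ e0).
  rewrite near_withinE => /nbhs_ballP[d /= d0 xd].
  have d20 : 0 < d / 2 by rewrite divr_gt0.
  (* With [s] within [d / 2] of [t] and [t'] within [C^-1 < d / 2] of [s], both times are within [d]
     of [t]. *)
  exists (ball t (d / 2), [set C | Num.max C0 (d / 2)^-1 < C]).
    split => /=; first exact: nbhsx_ballx.
    by apply: nbhs_pinfty_gt; rewrite num_real.
  move=> [s C] /= [ts]; rewrite gt_max => /andP[CC0 Cd] sab t' t'ab st'.
  have C0' : 0 < C by exact: le_lt_trans CC0.
  have Cd' : C^-1 < d / 2 by rewrite invf_plt.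
  apply: (@le_trans _ _ (C0 * `|x t' - x s|)); last by rewrite ler_wpM2r// ltW.
  have tsd : `|t - s| < d / 2 by exact: ts.
  apply: fe; rewrite -ball_normE/=; apply: xd => //.
    by rewrite /ball/=; lra.
  rewrite /ball/=; apply: (le_lt_trans (ler_distD s _ _)).
  by rewrite [X in _ + X]distrC; lra.
move=> [M [_ MP]]; exists (Num.max M 0 + 1).
  by rewrite ltr_wpDl// le_max lexx orbT.
move=> s t sab; apply: MP => //.
by rewrite ltr_pwDr// le_max lexx.
Qed.

Lemma measurable_comp_path (V : normedModType R) a b (x : R -> V) (f : V -> R) :
  {within `[a, b], continuous x} ->
  (forall t, t \in `[a, b] -> {for x t, continuous f}) ->
  measurable_fun `[a, b] (f \o x).
Proof.
move=> /subspace_continuousP xc fc.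
apply: subspace_continuous_measurable_fun => //.
apply/subspace_continuousP => t tab.
exact: (cvg_comp _ _ (xc t tab) (fc t tab)).
Qed.

End Paths.

(** * Power balance *)

(** Skewness kills [e^T J e], the term [- e^T D e] is at most 0, and [e^T G u] is the supplied
    power. *)
Lemma power_balance_le (R : realFieldType) n m (J D : 'M[R]_n) (G : 'M[R]_(n, m))
    (e : 'cV[R]_n) (u : 'cV[R]_m) :
  J = - J^T -> 0 <= (e^T *m D *m e) 0 0 ->
  (e^T *m (J *m e - D *m e + G *m u)) 0 0 <= ((G^T *m e)^T *m u) 0 0.
Proof.
move=> Jskew De.
have Je0 : (e^T *m J *m e) 0 0 = 0.
  (* A 1 by 1 matrix equals its transpose. *)
  have : (e^T *m J *m e) 0 0 = - (e^T *m J *m e) 0 0.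
    rewrite -{1}[e^T *m J *m e]trmxK mxE !trmx_mul trmxK mulmxA.
    by rewrite -[J^T]opprK -Jskew mulmxN mulNmx mxE.
  by move: ((e^T *m J *m e) 0 0) => c; lra.
rewrite trmx_mul trmxK mulmxDr mulmxBr !mulmxA.
rewrite [leLHS]mxE [X in X + _]mxE Je0 [X in _ + X + _]mxE; lra.
Qed.

Lemma mulmx_trE (R : comPzRingType) n (e v : 'cV[R]_n) :
  (e^T *m v) 0 0 = \sum_i e i 0 * v i 0.
Proof. by rewrite mxE; apply: eq_bigr => i _; rewrite mxE. Qed.

Section Paths.
Variables (R : realType) (n1 n2 : nat).
Variables (x1 : R -> 'cV[R]_n1) (x2 : R -> 'cV[R]_n2).

Lemma is_derive_comp_pair (H : 'cV[R]_n1 * 'cV[R]_n2 -> R) (t : R) v1 v2 :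
  is_derive t 1 x1 v1 -> is_derive t 1 x2 v2 ->
  differentiable H (x1 t, x2 t) ->
  is_derive t 1 (fun s => H (x1 s, x2 s))
    (((pgrad1 H (x1 t, x2 t))^T *m v1) 0 0 + ((pgrad2 H (x1 t, x2 t))^T *m v2) 0 0).
Proof.
move=> [/derivable1_diffP d1 <-] [/derivable1_diffP d2 <-] dH.
have d12 := differentiable_pair d1 d2.
have dHx : differentiable (H \o (fun s => (x1 s, x2 s))) t.
  exact: differentiable_comp.
apply: DeriveDef; first exact: diff_derivable.
rewrite deriveE// [LHS](_ : _ = ('d (H \o (fun s => (x1 s, x2 s))) t : R -> R) 1)//.
rewrite diff_comp//= diff_pair//= diff_pgrad//= !mulmx_trE -!deriveE//.
by congr (_ + _); apply: eq_bigr => i _; rewrite mulrC.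
Qed.

Lemma is_derive_dotmul (e : 'cV[R]_n1) (t : R) v1 : is_derive t 1 x1 v1 ->
  is_derive t 1 (fun s => (e^T *m x1 s) 0 0) ((e^T *m v1) 0 0).
Proof.
move=> [d1 <-]; have /derivable_mxP d1c := d1.
under eq_fun do rewrite mulmx_trE.
rewrite mulmx_trE derive_mx//.
have -> : (fun s => \sum_i e i 0 * x1 s i 0) = \sum_i (e i 0 *: (fun s => x1 s i 0)).
  by apply/funext => s; rewrite fct_sumE.
apply: is_derive_eq; last by apply: eq_bigr => i _; rewrite mxE.
apply: is_derive_sum => i; apply: is_deriveZ; exact/derivableP.
Qed.

End Paths.

Lemma measurable_dotmul (R : realType) m (D : set R) (y u : R -> 'cV[R]_m) :
  (forall i, measurable_fun D (fun t => y t i 0)) ->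
  (forall i, measurable_fun D (fun t => u t i 0)) ->
  measurable_fun D (fun t => ((y t)^T *m u t) 0 0).
Proof.
move=> my mu; under eq_fun do rewrite mulmx_trE.
by apply: measurable_sum => i; exact: measurable_funM.
Qed.

(** * The energy inequalities along a cyclic motion *)

Theorem theorem2 (R : realType) (n1 n2 m2 : nat) (Sys : two_port R n1 n2 m2)
  (sys_smooth : smooth_system Sys)
  (J_skew : skew_interconnection Sys)
  (R_dissipative : dissipative Sys)
  (G1_invertible : G1 Sys \in unitmx)
  (hess_full_rank : forall x, state_space Sys x -> \rank (phess1 (ham Sys) x) = n1)
  (tau : R) (tau_ge0 : 0 <= tau)
  (x1 : R -> 'cV[R]_n1) (x2 : R -> 'cV[R]_n2)
  (u1 : R -> 'cV[R]_n1) (u2 : R -> 'cV[R]_m2)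
  (cyclic : cyclic_motion Sys tau x1 x2 u1 u2)
  (ybar1 : 'cV[R]_n1)
  (y1_constant : forall t : R, t \in `[0, tau] -> y1 Sys (x1 t, x2 t) = ybar1) :
  (0 <= \int[lebesgue_measure]_(t in `[0%R, tau]) (((ybar1^T *m u1 t) 0 0)%R)%:E)%E /\
  (0 <= \int[lebesgue_measure]_(t in `[0%R, tau])
             ((((y2 Sys (x1 t, x2 t))^T *m u2 t) 0 0)%R)%:E)%E.
Proof.
have [oX [smH [_ [_ [_ [_ smG2]]]]]] := sys_smooth.
have [[xX mu1 mu2 ac1 ac2 ode1 ode2] [cyc1 cyc2]] := cyclic.
pose x t := (x1 t, x2 t).
have [dH _] := smH 1%N.
have acx : abs_continuous 0 tau x by exact: abs_continuous_pair.
have contx := abs_continuous_continuous acx.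
(* The solution of [G1^T e = ybar1]. *)
pose e := invmx (G1 Sys)^T *m ybar1.
have e1x t : t \in `[0, tau] -> e1 Sys (x t) = e.
  move=> /y1_constant; rewrite /y1 /e => <-.
  by rewrite mulKmx// unitmx_tr.
pose phi1 t := (e^T *m x1 t) 0 0.
(* Along the motion this is [H - e1^T x1], up to sign the partial Legendre transform of [H] in
   [x1]. *)
pose phi2 t := ham Sys (x t) - phi1 t.
(* The l1 norm of [e], dual to the max norm on states. *)
pose E := \sum_i `|e i 0|.
have phi1_lip s t : `|phi1 t - phi1 s| <= E * `|x t - x s|.
  have -> : phi1 t - phi1 s = (e^T *m (x1 t - x1 s)) 0 0.
    by rewrite mulmxBr /phi1 !mxE.
  rewrite mulmx_trE (le_trans (ler_norm_sum _ _ _))// mulr_suml ler_sum// => i _.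
  rewrite normrM ler_wpM2l// (le_trans (ler_norm_coord _ _))//.
  by rewrite prod_normE le_max lexx.
have acphi1 : abs_continuous 0 tau phi1.
  by apply: (abs_continuous_le_dist ltr01 acx) => s t _ _ _; exact: phi1_lip.
have [C C0 Hlip] : exists2 C, 0 < C &
    forall s t, s \in `[0, tau] -> t \in `[0, tau] -> `|t - s| < C^-1 ->
    `|ham Sys (x t) - ham Sys (x s)| <= C * `|x t - x s|.
  apply: lipschitz_along_path => // t tab.
  exact: (Ck1_locally_lipschitz oX (smH 1%N) (xX t tab)).
have acphi2 : abs_continuous 0 tau phi2.
  apply: (abs_continuous_le_dist (C := C + E) (d := C^-1) _ acx).
    by rewrite invr_gt0; exact: C0.
  move=> s t sab tab st; rewrite mulrDl.
  have -> : phi2 t - phi2 s =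
    (ham Sys (x t) - ham Sys (x s)) - (phi1 t - phi1 s) by rewrite /phi2; ring.
  by apply: (le_trans (ler_normB _ _)); apply: lerD; [exact: Hlip|exact: phi1_lip].
have FF := filter_lebesgue_ae R.
have oo_cc t : t \in `]0, tau[ -> t \in `[0, tau] by apply: subset_itv_oo_cc.
split.
- have phi1_0 : phi1 tau - phi1 0 = 0 by rewrite /phi1 cyc1 subrr.
  apply: le_trans (abs_continuous_le_integral tau_ge0 acphi1 _ _).
  - by rewrite phi1_0.
  - by apply: measurable_dotmul => // i; exact: measurable_cst.
  apply: (@filterS _ _ FF _ _ _ ode1) => t xt tab.
  have [d1 ->] := is_derive_dotmul e (xt tab).
  split; first exact: d1.
  (* Rewriting [ybar1] as [y1] and [e] as [e1] at time [t] gives the power balance of port 1. *)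
  have tab' := oo_cc _ tab; rewrite -(y1_constant _ tab') -(e1x _ tab').
  apply: power_balance_le; first by have [] := J_skew _ (xX _ tab').
  by have [+ _] := R_dissipative _ (xX _ tab'); apply.
- have phi2_0 : phi2 tau - phi2 0 = 0.
    by rewrite /phi2 /phi1 /x cyc1 cyc2 subrr.
  apply: le_trans (abs_continuous_le_integral tau_ge0 acphi2 _ _).
  - by rewrite phi2_0.
  - apply: measurable_dotmul => // i.
    have y2E t : y2 Sys (x1 t, x2 t) i 0 =
        \sum_j G2 Sys (x t) j i * e2 Sys (x t) j 0.
      by rewrite /y2 mxE; apply: eq_bigr => j _; rewrite mxE.
    rewrite (funext y2E).
    apply: measurable_sum => j; apply: measurable_funM.
      apply: (measurable_comp_path (f := fun z => G2 Sys z j i) contx) => t tab.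
      apply: (@continuous_comp _ _ _ (G2 Sys) (fun M => M j i)).
        exact: (smG2 0%N _ (xX t tab)).
      exact: coord_continuous.
    apply: (measurable_comp_path (f := fun z => e2 Sys z j 0) contx) => t tab.
    (* Entries of [e2] are directional derivatives of [H], hence continuous. *)
    rewrite (_ : (fun z => e2 Sys z j 0) = 'D_(0, delta_mx j 0) (ham Sys)).
      by have [_ cH] := smH 1%N; exact: cH _ _ (xX t tab).
    by apply/funext => z; exact: derive_pgrad2.
  apply: (@filterS2 _ _ FF _ _ _ _ ode1 ode2) => t xt1 xt2 tab.
  have tab' := oo_cc _ tab.
  have d1 := is_derive_dotmul e (xt1 tab).
  have dHx := is_derive_comp_pair (xt1 tab) (xt2 tab) (dH _ (xX _ tab')).
  have [d2 ->] := is_deriveB dHx d1.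
  split; first exact: d2.
  (* The derivative of [phi2] is [e1^T x1' + e2^T x2' - e^T x1']; as [e1 = e], only [e2^T x2']
     remains. *)
  rewrite -/(e1 Sys _) -/(e2 Sys _) e1x// addrAC subrr add0r.
  apply: power_balance_le; first by have [] := J_skew _ (xX _ tab').
  by have [_ +] := R_dissipative _ (xX _ tab'); apply.
Qed.
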